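(* There is a centered compound Poisson random vector $X$ in $\mathbb{R}^2$ with finite second moment and positive-definite covariance matrix such that $C_X(u_0)=0$ for one unit vector $u_0$, while $C_X(u_n)=\infty$ for all $n$ along some sequence of unit vectors $u_n\to u_0$.
   Context: For a centered infinitely divisible random vector $X$ in $\mathbb{R}^d$ with finite second moment and covariance matrix $\Sigma$, put $K_X(t):=\log\mathbb{E}e^{\langle t,X\rangle}$ (value $+\infty$ allowed) and $V_X(t):=t^\top\Sigma t$. Directional (radial) pole: if $V_X(t)>0$, $C_X(t)\in[0,\infty]$ is the infimum of all $c\in[0,\infty)$ such that $$K_X(st)\le\frac{V_X(t)s^2}{2(1-cs)}\qquad\text{for all }0\le s<1/c,$$ with $1/0=\infty$ and $\inf\emptyset=\infty$. If $V_X(t)=0$, $C_X(t):=0$. A centered compound Poisson vector is an infinitely divisible vector with no Gaussian component and finite Lévy measure, with the drift chosen so that its mean is zero. *)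

(* Defs.v *)
From mathcomp Require Import all_boot all_order all_algebra.
From mathcomp Require Import complex.
From mathcomp Require Import all_classical all_reals all_analysis.

Set Implicit Arguments.
Unset Strict Implicit.
Unset Printing Implicit Defensive.

Import Order.TTheory GRing.Theory Num.Theory.
Import numFieldNormedType.Exports.

Local Open Scope classical_set_scope.
Local Open Scope ring_scope.

(* Points of R^d at which measures live are [d.-tuple R], which carries the
   product (Borel) sigma-algebra; directions t are row vectors 'rV[R]_d, which
   carry the linear structure and the usual topology. *)

Section Vectors.
Context {R : realType} {d : nat}.
Implicit Types (t : 'rV[R]_d) (x y : d.-tuple R) (A : 'M[R]_d).

Definition vdot t x : R := \sum_(i < d) t 0 i * tnth x i.

Definition vadd x y : d.-tuple R := [tuple tnth x i + tnth y i | i < d].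

Definition vzero : d.-tuple R := [tuple 0 | i < d].

Definition sqnorm x : R := \sum_(i < d) tnth x i ^+ 2.

Definition unit_vector t : Prop := Num.sqrt (\sum_(i < d) t 0 i ^+ 2) = 1.

Definition qform A t : R := (t *m A *m t^T) 0 0.

Definition psdmx A : Prop := A^T = A /\ forall t, 0 <= qform A t.

Definition pdmx A : Prop := A^T = A /\ forall t, t != 0 -> 0 < qform A t.

End Vectors.

Section InfiniteDivisibility.
Context {R : realType} {d : nat}.

(* (mu * nu)(A) = \int nu (A - x) mu(dx) *)
Definition convolution (mu nu : set (d.-tuple R) -> \bar R)
    (A : set (d.-tuple R)) : \bar R :=
  (\int[mu]_x nu [set y | A (vadd x y)])%E.

Definition convolution_power (mu : set (d.-tuple R) -> \bar R) (n : nat) :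
    set (d.-tuple R) -> \bar R :=
  iter n (convolution mu) (fun A => \d_vzero A).

Definition infinitely_divisible (mu : set (d.-tuple R) -> \bar R) : Prop :=
  forall n : nat, (0 < n)%N ->
    exists nu : probability (d.-tuple R) R,
      forall A, measurable A -> mu A = convolution_power nu n A.

Definition levy_measure (nu : {measure set (d.-tuple R) -> \bar R}) : Prop :=
  nu [set vzero] = 0%E /\
  (\int[nu]_x (Num.min 1 (sqnorm x))%:E < +oo)%E.

(* Real and imaginary parts of
   i<b,t> - t A t^T / 2 + \int (e^{i<t,x>} - 1 - i<t,x> 1_{|x| <= 1}) nu(dx) *)
Definition levy_exponent (b : 'rV[R]_d) (A : 'M[R]_d)
    (nu : {measure set (d.-tuple R) -> \bar R}) (t : 'rV[R]_d) : R[i] :=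
  Complex
    (- (qform A t / 2) + \int[nu]_x (cos (vdot t x) - 1))
    (\sum_(i < d) b 0 i * t 0 i +
      \int[nu]_x (sin (vdot t x) -
                  (if sqnorm x <= 1 then vdot t x else 0))).

Definition cexp (z : R[i]) : R[i] :=
  let: Complex a b := z in Complex (expR a * cos b) (expR a * sin b).

End InfiniteDivisibility.

Section RandomVectors.
Context {R : realType} {d : nat} {disp : measure_display}
  {Omega : measurableType disp} (P : probability Omega R).
Variable X : {RV P >-> d.-tuple R}.
Implicit Types t : 'rV[R]_d.

Definition coord (i : 'I_d) : Omega -> R := fun w => tnth (X w) i.

Definition centered : Prop := forall i, ('E_P[coord i] = 0)%E.

Definition finite_second_moment : Prop :=
  ('E_P[fun w => sqnorm (X w)] < +oo)%E.

Definition covmx : 'M[R]_d :=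
  \matrix_(i, j) fine (covariance P (coord i) (coord j)).

Definition charfun t : R[i] :=
  Complex (fine ('E_P[fun w => cos (vdot t (X w))])%E)
          (fine ('E_P[fun w => sin (vdot t (X w))])%E).

Definition levy_triplet (b : 'rV[R]_d) (A : 'M[R]_d)
    (nu : {measure set (d.-tuple R) -> \bar R}) : Prop :=
  [/\ psdmx A, levy_measure nu &
      forall t, charfun t = cexp (levy_exponent b A nu t)].

Definition centered_compound_poisson : Prop :=
  [/\ infinitely_divisible (distribution P X),
      exists (b : 'rV[R]_d) (nu : {measure set (d.-tuple R) -> \bar R}),
        levy_triplet b 0 nu /\ (nu setT < +oo)%E &
      P.-integrable setT (fun w => (Num.sqrt (sqnorm (X w)))%:E) /\ centered].

Definition cumulant t : \bar R := lne ('E_P[fun w => expR (vdot t (X w))])%E.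

Definition variance_form t : R := qform covmx t.

(* In \bar R, 0^-1 = +oo and ereal_inf set0 = +oo. *)
Definition radial_pole t : \bar R :=
  if 0 < variance_form t then
    ereal_inf [set c%:E | c in [set c : R | 0 <= c /\
      forall s : R, 0 <= s -> (s%:E < (c%:E)^-1)%E ->
        (cumulant (s *: t) <=
           (variance_form t * s ^+ 2 / (2 * (1 - c * s)))%:E)%E]]
  else 0%E.

End RandomVectors.

(* Main.v *)
(* Jumps x_k = (-1, 2^k) with probabilities (7/8) 8^-k: the second coordinate has
   a finite second moment, but no exponential moment.  Let X be the centered
   compound Poisson vector of rate 1 with these jumps.  In the direction
   u_0 = (1, 0) all jumps equal -1, so K(s u_0) = e^-s - 1 + s <= s^2 / 2 and the
   radial pole is 0.  In a direction u = (cos a, sin a) with sin a > 0 the terms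
   8^-k e^(s 2^k sin a) do not tend to 0, so K(s u) = +oo for every s > 0 and the
   radial pole is +oo; let a tend to 0.

   The law of a compound Poisson vector is taken as the Poisson mixture of
   convolution powers of the jump law, and all its integrals are computed for
   nonnegative integrands: cosines are replaced by 1 + cos, and the mean is
   recovered from the second moments of c + <t, X>. *)

Require Import Defs.
From HB Require Import structures.
From mathcomp Require Import all_boot all_order all_algebra.
From mathcomp Require Import complex ring lra.
From mathcomp Require Import all_classical all_reals all_analysis.
From mathcomp Require Import measurable_realfun interval_inference.

Set Implicit Arguments.
Unset Strict Implicit.
Unset Printing Implicit Defensive.

Import Order.TTheory GRing.Theory Num.Theory.
Import numFieldNormedType.Exports.

Local Open Scope classical_set_scope.
Local Open Scope ring_scope.

(** * Series with Poisson weights *)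

Section RealSeries.
Context {R : realType}.
Implicit Types (x a b : R) (z : R[i]).

Lemma cvg_series_exp_coeff x : series (exp_coeff x) @ \oo --> expR x.
Proof. exact: is_cvg_series_exp_coeff. Qed.

(** For factorial moments of the Poisson law: a factor n in front of an exponential coefficient
    lowers its index by one, and the zeroth term lost in the shift is 0. *)
Lemma cvg_series_shift (u v : R^nat) (k l : R) :
  u 0%N = 0 -> (forall n, u n.+1 = k * v n) -> series v @ \oo --> l ->
  series u @ \oo --> k * l.
Proof.
move=> u0 uS vl; rewrite -cvg_shiftS.
rewrite (_ : (fun n => _) = (fun n => k * series v n)).
  exact: (cvgM (cvg_cst k) vl).
apply/funext => n; rewrite /series/= big_nat_recl//= u0 add0r mulr_sumr.
by apply: eq_bigr => i _; rewrite uS.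
Qed.

Lemma exp_coeffS x n : exp_coeff x n.+1 * n.+1%:R = x * exp_coeff x n.
Proof.
rewrite /exp_coeff/= factS natrM exprS.
have n0 : n`!%:R != 0 :> R by rewrite pnatr_eq0 -lt0n fact_gt0.
have n1 : n.+1%:R != 0 :> R by rewrite pnatr_eq0.
by rewrite invfM -mulrA [_^-1 * _ * _]mulrAC mulVf// mul1r mulrA.
Qed.

Definition poisson_weight x n : R := expR (- x) * exp_coeff x n.

Lemma poisson_weight_ge0 x n : 0 <= x -> 0 <= poisson_weight x n.
Proof. by move=> x0; rewrite mulr_ge0 ?expR_ge0// exp_coeff_ge0. Qed.

Lemma cvg_series_poisson_weight (v : R^nat) x (l : R) :
  series (fun n => exp_coeff x n * v n) @ \oo --> l ->
  series (fun n => poisson_weight x n * v n) @ \oo --> expR (- x) * l.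
Proof.
move=> vl; rewrite (_ : series _ =
    (fun n => expR (- x) * series (fun n => exp_coeff x n * v n) n)).
  exact: (cvgM (cvg_cst _) vl).
apply/funext => n; rewrite /series/= mulr_sumr.
by apply: eq_bigr => i _; rewrite mulrA.
Qed.

(** This is the probability generating function of a Poisson variable of mean x. *)
Lemma cvg_series_poisson_exp x y :
  series (fun n => poisson_weight x n * y ^+ n) @ \oo --> expR (x * (y - 1)).
Proof.
rewrite mulrBr mulr1 expRD mulrC; apply: cvg_series_poisson_weight.
rewrite (_ : (fun n => _) = exp_coeff (x * y)); first exact: cvg_series_exp_coeff.
by apply/funext => n; rewrite /exp_coeff/= exprMn mulrAC.
Qed.

(** For N Poisson of mean x the factorial moments are E N = x and E N(N - 1) = x^2; hence quadratics
    in n are written in the basis 1, n, n(n - 1). *)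
Lemma cvg_series_poisson_quadratic x a b c :
  series (fun n => poisson_weight x n * (a + b * n%:R + c * (n%:R * (n%:R - 1))))
    @ \oo --> a + b * x + c * x ^+ 2.
Proof.
have e1 : series (fun n => exp_coeff x n * n%:R) @ \oo --> x * expR x.
  apply: (@cvg_series_shift _ (exp_coeff x)); first by rewrite mulr0.
    by move=> n; rewrite exp_coeffS.
  exact: cvg_series_exp_coeff.
have e2 : series (fun n => exp_coeff x n * (n%:R * (n%:R - 1))) @ \oo -->
    x * (x * expR x).
  apply: cvg_series_shift e1; first by rewrite mul0r mulr0.
  move=> n; have -> : n.+1%:R - 1 = n%:R :> R by rewrite -natr1 addrK.
  by rewrite [LHS]mulrA exp_coeffS mulrA.
rewrite (_ : _ + _ = expR (- x) *
    (a * expR x + b * (x * expR x) + c * (x * (x * expR x)))); last first.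
  have e0 : expR x != 0 by rewrite expR_eq0.
  by rewrite expRN; field.
apply: cvg_series_poisson_weight.
rewrite (_ : series _ = fun n => a * series (exp_coeff x) n +
  b * series (fun n => exp_coeff x n * n%:R) n +
  c * series (fun n => exp_coeff x n * (n%:R * (n%:R - 1))) n).
  apply: cvgD; last exact: (cvgM (cvg_cst _) e2).
  apply: cvgD; last exact: (cvgM (cvg_cst _) e1).
  by apply: cvgM; [exact: cvg_cst | exact: cvg_series_exp_coeff].
apply/funext => n; rewrite /series/= !mulr_sumr -!big_split/=.
by apply: eq_bigr => i _; ring.
Qed.

(** * The complex exponential series through two real power series *)

Lemma complexReM (z z' : R[i]) :
  complex.Re (z * z') = complex.Re z * complex.Re z' - complex.Im z * complex.Im z'.
Proof. by case: z z' => [a b] [a' b']. Qed.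

Lemma complexImM (z z' : R[i]) :
  complex.Im (z * z') = complex.Re z * complex.Im z' + complex.Im z * complex.Re z'.
Proof. by case: z z' => [a b] [a' b']. Qed.

(** For fixed z, [zRe] and [zIm] are the Taylor coefficients of Re e^(xz) and Im e^(xz) in the real
    variable x, so that termwise differentiation of real power series applies. *)
Let zRe z n : R := n`!%:R^-1 * complex.Re (z ^+ n).
Let zIm z n : R := n`!%:R^-1 * complex.Im (z ^+ n).

Let natr_factS n : n.+1%:R * n.+1`!%:R^-1 = n`!%:R^-1 :> R.
Proof. by rewrite factS natrM invfM mulVKf// pnatr_eq0. Qed.

Let zRe_diffs z : pseries_diffs (zRe z) =
  (fun n => complex.Re z * zRe z n - complex.Im z * zIm z n).
Proof.
apply/funext => n; rewrite /pseries_diffs /zRe /zIm mulrA natr_factS exprS.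
by rewrite complexReM; ring.
Qed.

Let zIm_diffs z : pseries_diffs (zIm z) =
  (fun n => complex.Re z * zIm z n + complex.Im z * zRe z n).
Proof.
apply/funext => n; rewrite /pseries_diffs /zRe /zIm mulrA natr_factS exprS.
by rewrite complexImM; ring.
Qed.

(** The norm |Re z| + |Im z| is submultiplicative, which bounds both parts of z^n at once. *)
Let norm_zpow z n :
  `|complex.Re (z ^+ n)| + `|complex.Im (z ^+ n)| <=
  (`|complex.Re z| + `|complex.Im z|) ^+ n.
Proof.
elim: n => [|n IH]; first by rewrite !expr0/= normr1 normr0 addr0.
rewrite exprS complexReM complexImM [leRHS]exprS.
apply: le_trans (ler_wpM2l _ IH); last by rewrite addr_ge0.
apply: le_trans (lerD (ler_normB _ _) (ler_normD _ _)) _.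
by rewrite !normrM le_eqVlt; apply/orP; left; apply/eqP; ring.
Qed.

Let cvg_pseries_bounded (u : R^nat) (k x : R) :
  (forall n, `|u n| <= n`!%:R^-1 * k ^+ n) -> cvgn (pseries u x).
Proof.
move=> uk; apply: normed_cvg.
apply: (@series_le_cvg _ _ (exp_coeff (k * `|x|))).
- by move=> n /=.
- move=> n; rewrite /exp_coeff/= exprMn.
  rewrite mulrAC mulr_ge0 ?exprn_ge0// mulrC.
  exact: le_trans (normr_ge0 _) (uk n).
- move=> n; rewrite /= normrM normrX /exp_coeff/= exprMn.
  apply: le_trans (ler_wpM2r _ (uk n)) _; first by rewrite exprn_ge0.
  by rewrite -mulrA mulrC.
- exact: is_cvg_series_exp_coeff.
Qed.

Let is_cvg_zRe z x : cvgn (pseries (zRe z) x).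
Proof.
apply: (@cvg_pseries_bounded _ (`|complex.Re z| + `|complex.Im z|)) => n.
rewrite /zRe normrM ger0_norm// ler_wpM2l//.
by apply: le_trans (norm_zpow z n); rewrite lerDl.
Qed.

Let is_cvg_zIm z x : cvgn (pseries (zIm z) x).
Proof.
apply: (@cvg_pseries_bounded _ (`|complex.Re z| + `|complex.Im z|)) => n.
rewrite /zIm normrM ger0_norm// ler_wpM2l//.
by apply: le_trans (norm_zpow z n); rewrite lerDr.
Qed.

Let cvg_pseries_lin (u v : R^nat) (h k x l m : R) :
  pseries u x @ \oo --> l -> pseries v x @ \oo --> m ->
  pseries (fun n => h * u n + k * v n) x @ \oo --> h * l + k * m.
Proof.
move=> ul vm; rewrite (_ : pseries _ x =
    fun n => h * pseries u x n + k * pseries v x n).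
  apply: cvgD; [exact: (cvgM (cvg_cst h) ul) | exact: (cvgM (cvg_cst k) vm)].
apply/funext => n; rewrite /pseries /series/= !mulr_sumr -big_split/=.
by apply: eq_bigr => i _; ring.
Qed.

Let C z x := limn (pseries (zRe z) x).
Let S z x := limn (pseries (zIm z) x).

Let cvg_zRe_diffs z x :
  pseries (pseries_diffs (zRe z)) x @ \oo -->
  complex.Re z * C z x + (- complex.Im z) * S z x.
Proof.
rewrite zRe_diffs; under eq_fun do rewrite -mulNr.
by apply: cvg_pseries_lin; [exact: is_cvg_zRe | exact: is_cvg_zIm].
Qed.

Let cvg_zIm_diffs z x :
  pseries (pseries_diffs (zIm z)) x @ \oo -->
  complex.Re z * S z x + complex.Im z * C z x.
Proof.
rewrite zIm_diffs.
by apply: cvg_pseries_lin; [exact: is_cvg_zIm | exact: is_cvg_zRe].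
Qed.

Let pseries_diffs_lin (u v : R^nat) (h k : R) :
  pseries_diffs (fun n => h * u n + k * v n) =
  (fun n => h * pseries_diffs u n + k * pseries_diffs v n).
Proof. by apply/funext => n; rewrite /pseries_diffs; ring. Qed.

Let is_derive_C z x :
  is_derive x 1 (C z) (complex.Re z * C z x + (- complex.Im z) * S z x).
Proof.
rewrite -(cvg_lim _ (@cvg_zRe_diffs z x))//.
(* Termwise differentiation at x requires the series and its first two formal derivatives to
   converge at some point beyond |x|. They converge everywhere, and |x| + 1 is taken. *)
apply: (@pseries_snd_diffs _ _ (`|x| + 1)).
- exact: is_cvg_zRe.
- by apply: cvgP; exact: cvg_zRe_diffs.
- rewrite zRe_diffs; under eq_fun do rewrite -mulNr.
  rewrite pseries_diffs_lin; apply: cvgP.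
  exact: cvg_pseries_lin (@cvg_zRe_diffs z _) (@cvg_zIm_diffs z _).
- by rewrite [ltRHS]ger0_norm// ltrDl.
Qed.

Let is_derive_S z x :
  is_derive x 1 (S z) (complex.Re z * S z x + complex.Im z * C z x).
Proof.
rewrite -(cvg_lim _ (@cvg_zIm_diffs z x))//.
apply: (@pseries_snd_diffs _ _ (`|x| + 1)).
- exact: is_cvg_zIm.
- by apply: cvgP; exact: cvg_zIm_diffs.
- rewrite zIm_diffs pseries_diffs_lin; apply: cvgP.
  exact: cvg_pseries_lin (@cvg_zIm_diffs z _) (@cvg_zRe_diffs z _).
- by rewrite [ltRHS]ger0_norm// ltrDl.
Qed.

Let pseries0 (u : R^nat) : limn (pseries u 0) = u 0%N.
Proof.
apply/cvg_lim => //; rewrite -cvg_shiftS.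
rewrite (_ : (fun n => _) = cst (u 0%N)); first exact: cvg_cst.
apply/funext => n; rewrite /pseries /series/= big_nat_recl//= expr0 mulr1.
by rewrite big1 ?addr0// => i _; rewrite expr0n/= mulr0.
Qed.

(* The pair (C, S) solves y' = z y, so that y e^{-xz} is constant. *)
Let CS_exp z x (a := complex.Re z) (b := complex.Im z) :
  C z x = expR (x * a) * cos (x * b) /\ S z x = expR (x * a) * sin (x * b).
Proof.
(* F and G are the real and imaginary parts of (C + iS) e^(-yz), with initial values 1 and 0;
   multiplying back by e^(xz) then gives C and S. *)
pose F (y : R) := expR (- (y * a)) * (C z y * cos (y * b) + S z y * sin (y * b)).
pose G (y : R) := expR (- (y * a)) * (S z y * cos (y * b) - C z y * sin (y * b)).
have F1 : F x = 1.
  transitivity (F 0); last first.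
    rewrite /F /C /S !mul0r oppr0 expR0 cos0 sin0 !pseries0 /zRe /zIm fact0.
    by rewrite invr1 !expr0/=; ring.
  apply: is_derive_0_is_cst => y.
  have := is_derive_C z y; have := is_derive_S z y => dS dC.
  apply: trigger_derive.
  rewrite /GRing.scale/= -/a -/b; ring.
have G0 : G x = 0.
  transitivity (G 0); last first.
    rewrite /G /C /S !mul0r oppr0 expR0 cos0 sin0 !pseries0 /zRe /zIm fact0.
    by rewrite invr1 !expr0/=; ring.
  apply: is_derive_0_is_cst => y.
  have := is_derive_C z y; have := is_derive_S z y => dS dC.
  apply: trigger_derive.
  rewrite /GRing.scale/= -/a -/b; ring.
have E : expR (x * a) * expR (- (x * a)) = 1 by rewrite expRxMexpNx_1.
have D : cos (x * b) ^+ 2 + sin (x * b) ^+ 2 = 1 by rewrite cos2Dsin2.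
split.
  transitivity (expR (x * a) * (F x * cos (x * b) - G x * sin (x * b))); last first.
    by rewrite F1 G0; ring.
  rewrite /F /G; transitivity ((expR (x * a) * expR (- (x * a))) *
    (C z x * (cos (x * b) ^+ 2 + sin (x * b) ^+ 2))); last by ring.
  by rewrite E D mul1r mulr1.
transitivity (expR (x * a) * (F x * sin (x * b) + G x * cos (x * b))); last first.
  by rewrite F1 G0; ring.
rewrite /F /G; transitivity ((expR (x * a) * expR (- (x * a))) *
  (S z x * (cos (x * b) ^+ 2 + sin (x * b) ^+ 2))); last by ring.
by rewrite E D mul1r mulr1.
Qed.

(** The bracket is 1 + Re(e^(ic) z^n), and the Poisson mean of z^N is e^(x(z - 1)). The summand 1
    will make the integrand 1 + cos nonnegative. *)
Lemma cvg_series_poisson_cos x z (c : R) :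
  series (fun n => poisson_weight x n * (1 + (cos c * complex.Re (z ^+ n)
    - sin c * complex.Im (z ^+ n)))) @ \oo -->
  1 + expR (x * (complex.Re z - 1)) * cos (c + x * complex.Im z).
Proof.
rewrite (_ : 1 + _ = expR (- x) * (expR x +
    (cos c * C z x + (- sin c) * S z x))); last first.
  have [-> ->] := CS_exp z x.
  rewrite [RHS]mulrDr -expRD addNr expR0 [x * (_ - 1)]mulrBr mulr1.
  rewrite [x * _ - x]addrC expRD cosD; ring.
apply: cvg_series_poisson_weight.
rewrite (_ : series _ = fun n => series (exp_coeff x) n +
    pseries (fun n => cos c * zRe z n + (- sin c) * zIm z n) x n).
  apply: cvgD; first exact: cvg_series_exp_coeff.
  by apply: cvg_pseries_lin; [exact: is_cvg_zRe | exact: is_cvg_zIm].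
apply/funext => n; rewrite /pseries /series/= -big_split/=.
by apply: eq_bigr => i _; rewrite /exp_coeff /zRe /zIm/=; ring.
Qed.

End RealSeries.

(** * Convolution powers and compound Poisson laws *)

Section Convolution.
Context {R : realType} {d : nat}.
Local Notation T := (d.-tuple R).
Implicit Types (x y z w : T) (t : 'rV[R]_d) (A : set T) (F : T -> \bar R).

Definition vscale (k : R) x : T := [tuple k * tnth x i | i < d].

Lemma vdot_vadd t x y : vdot t (vadd x y) = vdot t x + vdot t y.
Proof.
by rewrite /vdot -big_split/=; apply: eq_bigr => i _; rewrite tnth_mktuple mulrDr.
Qed.

Lemma vdot_vscale t k x : vdot t (vscale k x) = k * vdot t x.
Proof.
by rewrite /vdot mulr_sumr; apply: eq_bigr => i _; rewrite tnth_mktuple mulrCA.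
Qed.

Lemma vdotZ k t x : vdot (k *: t) x = k * vdot t x.
Proof.
by rewrite /vdot mulr_sumr; apply: eq_bigr => i _; rewrite mxE mulrA.
Qed.

Lemma vdot_vzero t : vdot t vzero = 0.
Proof. by rewrite /vdot big1// => i _; rewrite tnth_mktuple mulr0. Qed.

Lemma vaddA x y z : vadd x (vadd y z) = vadd (vadd x y) z.
Proof. by apply: eq_from_tnth => i; rewrite !tnth_mktuple addrA. Qed.

Lemma vaddACA x y z w : vadd (vadd x y) (vadd z w) = vadd (vadd x z) (vadd y w).
Proof. by apply: eq_from_tnth => i; rewrite !tnth_mktuple addrACA. Qed.

Lemma vadd0x x : vadd vzero x = x.
Proof. by apply: eq_from_tnth => i; rewrite !tnth_mktuple add0r. Qed.

Lemma vscaleDl (k l : R) x : vscale (k + l) x = vadd (vscale k x) (vscale l x).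
Proof. by apply: eq_from_tnth => i; rewrite !tnth_mktuple mulrDl. Qed.

Lemma vscale0 x : vscale 0 x = vzero.
Proof. by apply: eq_from_tnth => i; rewrite !tnth_mktuple mul0r. Qed.

Lemma measurable_vdot t : measurable_fun setT (vdot t).
Proof.
apply: measurable_sum => i; apply: measurable_funM => //.
exact: measurable_tnth.
Qed.

Lemma measurable_sqnorm : measurable_fun setT (@sqnorm R d).
Proof.
by apply: measurable_sum => i; apply: measurable_funX; exact: measurable_tnth.
Qed.

Lemma measurable_vaddl x : measurable_fun setT (vadd x).
Proof.
apply/measurable_fun_tnthP => i; rewrite (_ : _ \o _ =
  (fun y => tnth x i + tnth y i)); last first.
  by apply/funext => y; rewrite /= tnth_mktuple.
by apply: measurable_funD => //; exact: measurable_tnth.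
Qed.

Definition vaddp (p : T * T) : T := vadd p.1 p.2.

Lemma measurable_vaddp : measurable_fun setT vaddp.
Proof.
apply/measurable_fun_tnthP => i; rewrite (_ : _ \o _ =
  (fun p => tnth p.1 i + tnth p.2 i)); last first.
  by apply/funext => y; rewrite /= tnth_mktuple.
apply: measurable_funD.
  exact: (measurableT_comp (measurable_tnth i) measurable_fst).
exact: (measurableT_comp (measurable_tnth i) measurable_snd).
Qed.

HB.instance Definition _ x := isMeasurableFun.Build _ _ _ _ (vadd x)
  (measurable_vaddl x).
HB.instance Definition _ := isMeasurableFun.Build _ _ _ _ vaddp measurable_vaddp.

(** As the image of a product measure under addition, the convolution comes with its probability
    structure; [convE] identifies its values with those of [convolution]. *)
Definition conv (mu nu : probability T R) : probability T R :=
  distribution (mu \x nu)%E vaddp.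

Definition convn (J : probability T R) n : probability T R :=
  iter n (conv J) \d_vzero.

Lemma convnS J n : convn J n.+1 = conv J (convn J n). Proof. by []. Qed.

Lemma measurable_preimage_vadd x A : measurable A ->
  measurable [set y | A (vadd x y)].
Proof.
by move=> mA; rewrite -[X in measurable X]setTI; exact: measurable_vaddl.
Qed.

Lemma measurable_measure_vadd (mu : probability T R) A : measurable A ->
  measurable_fun setT (fun x => mu [set y | A (vadd x y)]).
Proof.
move=> mA; have mV : measurable (vaddp @^-1` A).
  by rewrite -[X in measurable X]setTI; exact: measurable_vaddp.
have := measurable_fun_xsection mu mV.
apply: eq_measurable_fun => x _ /=; congr (mu _).
by apply/seteqP; split => y /=; rewrite /xsection/= inE.
Qed.

Lemma convE (mu nu : probability T R) A : measurable A ->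
  conv mu nu A = convolution mu nu A.
Proof.
move=> mA; rewrite /conv/= /distribution /pushforward /product_measure1.
apply: eq_integral => x _; congr (nu _).
by apply/seteqP; split => y /=; rewrite /xsection/= inE.
Qed.

Local Open Scope ereal_scope.

Lemma measurable_vaddF F x : measurable_fun setT F ->
  measurable_fun setT (fun y => F (vadd x y)).
Proof. by move=> mF; apply: measurableT_comp => //; exact: measurable_vaddl. Qed.

Lemma ge0_integral_conv (mu nu : probability T R) F :
  measurable_fun setT F -> (forall x, 0 <= F x) ->
  \int[conv mu nu]_z F z = \int[mu]_x \int[nu]_y F (vadd x y).
Proof.
move=> mF F0; rewrite /conv ge0_integral_distribution//.
rewrite fubini_tonelli1//.
  by apply: measurableT_comp => //; exact: measurable_vaddp.
by move=> p /=.
Qed.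

(** Induction on m: Tonelli peels off one factor J, and associativity of addition moves it across.
    The set A varies because the inner integral evaluates translates of A. *)
Lemma convolution_convn J m n A : measurable A ->
  convolution (convn J m) (convn J n) A = convn J (m + n) A.
Proof.
move=> mA; elim: m A mA => [|m IH] A mA.
  rewrite /convolution integral_dirac//=; last exact: measurable_measure_vadd.
  rewrite diracT mul1e add0n; congr (convn J n _).
  by apply/seteqP; split=> y /=; rewrite vadd0x.
rewrite addSn !convnS convE// [LHS]ge0_integral_conv//; last first.
  exact: measurable_measure_vadd.
apply: eq_integral => x _; rewrite -IH; last exact: measurable_preimage_vadd.
apply: eq_integral => y _; congr (convn J n _).
by apply/seteqP; split=> z /=; rewrite vaddA.
Qed.

End Convolution.

(** * Series of nonnegative extended reals *)

Section NonnegativeSeries.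
Context {R : realType}.
Local Open Scope ereal_scope.

Lemma eseries_EFin (u : R^nat) (l : R) :
  series u @ \oo --> l -> \sum_(n <oo) (u n)%:E = l%:E.
Proof.
move=> ul; apply/cvg_lim => //.
rewrite (_ : (fun n => _) = EFin \o series u).
  by apply: (cvg_comp _ _ ul).
by apply/funext => n; rewrite /series/= sumEFin.
Qed.

Lemma nneseries_antidiagonal (f : nat -> nat -> \bar R) :
  (forall i j, 0 <= f i j) ->
  \sum_(i <oo) \sum_(j <oo) f i j =
  \sum_(n <oo) \sum_(0 <= i < n.+1) f i (n - i)%N.
Proof.
move=> f0.
(* Row i is shifted right by i places and padded with zeros, so that antidiagonals become columns;
   exchanging the two sums then does the regrouping. *)
pose g i n := if (i <= n)%N then f i (n - i)%N else 0.
have g0 i n : 0 <= g i n by rewrite /g; case: ifP.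
transitivity (\sum_(i <oo) \sum_(n <oo) g i n).
  apply: eq_eseriesr => i _; rewrite /g.
  rewrite -(eseries_mkcond (P := fun n => (i <= n)%N) (fun n => f i (n - i)%N)).
  rewrite -ereal_series -[RHS]nneseries_addn//.
  by apply: eq_eseriesr => j _; rewrite addnK.
rewrite nneseries_interchange//; apply: eq_eseriesr => n _.
rewrite (@nneseries_split _ (g ^~ n) 0%N n.+1)// add0n.
rewrite [X in _ + X]eseries0 ?adde0; last first.
  by move=> i ni _; rewrite /g leqNgt ni.
by apply: eq_big_nat => i /= ni; rewrite /g -ltnS ni.
Qed.

End NonnegativeSeries.

(** * Compound Poisson laws as a convolution semigroup in the rate *)

Section CompoundPoisson.
Context {R : realType} {d : nat}.
Local Notation T := (d.-tuple R).
Implicit Types (b : T) (l : {nonneg R}) (J : probability T R).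
Local Open Scope ereal_scope.

Definition poisson_nng l n : {nonneg R} :=
  NngNum (@poisson_weight_ge0 R l%:num n (ge0 l)).

Let cpois_term b l J n : {measure set T -> \bar R} :=
  mscale (poisson_nng l n) (distribution (convn J n) (vadd (vscale l%:num b))).

(* Law of [l b + Y_1 + ... + Y_N] with [N] Poisson of mean [l] and the [Y_i]
   independent of law [J]. *)
Definition cpois b l J : set T -> \bar R := mseries (cpois_term b l J) 0.

HB.instance Definition _ b l J := Measure.on (cpois b l J).

Lemma sum_poisson_weight l : \sum_(n <oo) (poisson_weight l%:num n)%:E = 1.
Proof.
apply: eseries_EFin; have := @cvg_series_poisson_exp R l%:num 1.
rewrite subrr mulr0 expR0.
rewrite (_ : (fun n => _) = poisson_weight l%:num)//.
by apply/funext => n; rewrite expr1n mulr1.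
Qed.

Lemma cpoisE b l J A : cpois b l J A = \sum_(n <oo)
  (poisson_weight l%:num n)%:E * convn J n [set y | A (vadd (vscale l%:num b) y)].
Proof. by []. Qed.

Let cpois_setT b l J : cpois b l J setT = 1.
Proof.
rewrite cpoisE -(sum_poisson_weight l); apply: eq_eseriesr => n _.
by rewrite -[RHS]mule1; congr (_ * _); exact: probability_setT.
Qed.

HB.instance Definition _ b l J :=
  Measure_isProbability.Build _ _ _ (cpois b l J) (cpois_setT b l J).

Lemma ge0_integral_cpois b l J (F : T -> \bar R) :
  measurable_fun setT F -> (forall x, 0 <= F x) ->
  \int[cpois b l J]_x F x = \sum_(n <oo) (poisson_weight l%:num n)%:E *
    \int[convn J n]_y F (vadd (vscale l%:num b) y).
Proof.
move=> mF F0; rewrite /cpois ge0_integral_measure_series//.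
apply: eq_eseriesr => n _; rewrite ge0_integral_mscale//.
by rewrite ge0_integral_distribution.
Qed.

Lemma integral_cpois_EFin b l J (f : T -> R) (g : R^nat) (L : R) :
  measurable_fun setT f -> (forall x, 0 <= f x)%R ->
  (forall n, \int[convn J n]_y (f (vadd (vscale l%:num b) y))%:E = (g n)%:E) ->
  series (fun n => poisson_weight l%:num n * g n)%R @ \oo --> L ->
  \int[cpois b l J]_x (f x)%:E = L%:E.
Proof.
move=> mf f0 fg gL; rewrite ge0_integral_cpois//.
- by under eq_eseriesr do rewrite fg -EFinM; exact: eseries_EFin.
- exact/measurable_EFinP.
Qed.

(** By the binomial theorem, independent Poisson variables of means l and k add up to one of mean l
    + k. *)
Lemma poisson_weightD (l k : R) n :
  (\sum_(0 <= i < n.+1) poisson_weight l i * poisson_weight k (n - i) =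
   poisson_weight (l + k) n)%R.
Proof.
rewrite /poisson_weight /exp_coeff/= opprD expRD.
rewrite [(l + k)%R]addrC exprDn mulr_suml mulr_sumr big_mkord.
apply: eq_bigr => i _; have ni : (i <= n)%N by rewrite -ltnS.
have fac j : (j`!%:R != 0 :> R)%R by rewrite pnatr_eq0 -lt0n fact_gt0.
rewrite -(bin_fact ni) -mulr_natr !natrM.
have b0 : ('C(n, i)%:R != 0 :> R)%R by rewrite pnatr_eq0 -lt0n bin_gt0.
by field; rewrite !fac b0.
Qed.

(** Both sides are expanded by the numbers i and j of jumps and regrouped by i + j; the jump parts
    combine by [convolution_convn], the weights by [poisson_weightD]. The shifts add because they
    are proportional to the rate. The rate m enters through an equation, so any bundled nonnegative
    number with the right value can be used. *)
Lemma convolution_cpois b l (k m : {nonneg R}) J A : measurable A ->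
  m%:num = (l%:num + k%:num)%R ->
  convolution (cpois b l J) (cpois b k J) A = cpois b m J A.
Proof.
move=> mA mE; pose B := [set z | A (vadd (vscale m%:num b) z)].
have mB : measurable B by exact: measurable_preimage_vadd.
have w0 (x : {nonneg R}) n : 0 <= (poisson_weight x%:num n)%:E.
  by rewrite lee_fin poisson_weight_ge0.
rewrite /convolution ge0_integral_cpois//; last exact: measurable_measure_vadd.
transitivity (\sum_(i <oo) \sum_(j <oo)
    ((poisson_weight l%:num i)%:E * ((poisson_weight k%:num j)%:E *
      convn J (i + j) B))).
  apply: eq_eseriesr => i _; rewrite nneseriesZl//; last first.
    by move=> j _; rewrite mule_ge0.
  congr (_ * _); transitivity (\int[convn J i]_x \sum_(j <oo)
      (poisson_weight k%:num j)%:E * convn J j [set y | B (vadd x y)]).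
    apply: eq_integral => x _; rewrite cpoisE; apply: eq_eseriesr => j _.
    congr (_ * convn J j _); apply/seteqP; rewrite /B mE vscaleDl.
    by split=> y /=; rewrite vaddACA.
  rewrite integral_nneseries//; last 2 first.
  - by move=> j; apply: measurable_funeM; exact: measurable_measure_vadd.
  - by move=> j x _; rewrite mule_ge0.
  apply: eq_eseriesr => j _; rewrite ge0_integralZl//.
  - by rewrite -(convolution_convn J i j mB).
  - exact: measurable_measure_vadd.
rewrite nneseries_antidiagonal//; last first.
  by move=> i j; rewrite !mule_ge0.
rewrite cpoisE; apply: eq_eseriesr => n _; rewrite -/B.
rewrite (@eq_big_nat _ _ _ _ _ _
  (fun i => (poisson_weight l%:num i * poisson_weight k%:num (n - i))%:E *
    convn J n B)); last first.
  by move=> i /= ni; rewrite EFinM muleA subnKC.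
rewrite -ge0_sume_distrl; last first.
  by move=> i _; rewrite EFinM mule_ge0.
by rewrite sumEFin poisson_weightD mE.
Qed.

(** At rate 0 only the term without jumps survives, with weight 0^0 = 1, and the shift vanishes
    too. *)
Lemma cpois_rate0 b l J A : l%:num = 0%R -> cpois b l J A = \d_vzero A.
Proof.
move=> l0; rewrite cpoisE nneseries_recl//; last first.
  by move=> n _; rewrite mule_ge0// lee_fin poisson_weight_ge0.
rewrite eseries0 ?adde0; last first.
  move=> [//|n] _ _; rewrite /poisson_weight /exp_coeff/= l0 expr0n/=.
  by rewrite mul0r mulr0 mul0e.
rewrite /poisson_weight /exp_coeff/= l0 oppr0 expR0 expr0 fact0 divr1 mulr1 mul1e.
rewrite vscale0; congr (\d_ _ _).
by apply/seteqP; split=> y /=; rewrite vadd0x.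
Qed.

Lemma infinitely_divisible_cpois b l J : infinitely_divisible (cpois b l J).
Proof.
move=> n n0.
have k_ge0 m : (0 <= l%:num * (m%:R / n%:R))%R by rewrite mulr_ge0.
(* The n-th convolution root has rate l / n; its m-th power is shown to have rate l m / n, and m = n
   gives back l. *)
pose k m : {nonneg R} := NngNum (k_ge0 m).
exists (cpois b (k 1%N) J) => A mA.
suff {A mA} H m A : measurable A ->
    convolution_power (cpois b (k 1%N) J) m A = cpois b (k m) J A.
  rewrite H//; congr (cpois b _ J A); apply/val_inj => /=.
  by rewrite divff ?mulr1// pnatr_eq0 -lt0n.
elim: m A => [|m IH] A mA.
  by rewrite cpois_rate0//= mul0r mulr0.
rewrite -(@convolution_cpois b (k 1%N) (k m))//; last first.
  by rewrite /= -mulrDr -mulrDl -natrD add1n.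
apply: eq_integral => x _; apply: IH; exact: measurable_preimage_vadd.
Qed.

End CompoundPoisson.

(** * Means under a compound Poisson law *)

Section HasMean.
Context {R : realType} {disp : measure_display} {T : measurableType disp}.
Variable P : probability T R.
Implicit Types (f g : T -> R) (k a b : R).

(** Integrability travels with the value, so that linear combinations of means need no separate side
    conditions. *)
Definition has_mean f a : Prop :=
  P.-integrable setT (EFin \o f) /\ (\int[P]_x (f x)%:E = a%:E)%E.

Lemma has_mean_integrable f : P.-integrable setT (EFin \o f) ->
  has_mean f (\int[P]_x f x).
Proof. by move=> fi; split=> //; rewrite fineK//; exact: integrable_fin_num. Qed.

Lemma has_mean_Rintegral f a : has_mean f a -> \int[P]_x f x = a.
Proof. by move=> [_ fa]; rewrite /Rintegral fa. Qed.

Lemma has_mean_ge0 f a : measurable_fun setT f -> (forall x, 0 <= f x) ->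
  (\int[P]_x (f x)%:E = a%:E)%E -> has_mean f a.
Proof.
move=> mf f0 fa; split=> //; apply/integrableP; split.
  exact/measurable_EFinP.
by under eq_integral do rewrite /= ger0_norm//; rewrite fa ltry.
Qed.

Lemma has_mean_cst k : has_mean (cst k) k.
Proof.
split; first exact: finite_measure_integrable_cst.
by rewrite (integral_cst _ _ k%:E)//= probability_setT mule1.
Qed.

Lemma has_meanD f g a b : has_mean f a -> has_mean g b ->
  has_mean (fun x => f x + g x) (a + b).
Proof.
move=> [fi fa] [gi gb]; split; first exact: (integrableD measurableT fi gi).
by under eq_integral do rewrite EFinD; rewrite (integralD_EFin measurableT fi gi) fa gb.
Qed.

Lemma has_meanZ k f a : has_mean f a -> has_mean (fun x => k * f x) (k * a).
Proof.
move=> [fi fa]; split; first exact: (integrableZl measurableT k fi).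
by under eq_integral do rewrite EFinM; rewrite (integralZl measurableT fi) fa.
Qed.

Lemma has_mean_eq f g a b : f =1 g -> a = b -> has_mean f a -> has_mean g b.
Proof. by move=> /funext -> ->. Qed.

Lemma has_mean_sum n (f : 'I_n -> T -> R) (a : 'I_n -> R) :
  (forall i, has_mean (f i) (a i)) ->
  has_mean (fun x => \sum_(i < n) f i x) (\sum_(i < n) a i).
Proof.
elim: n f a => [|n IH] f a fa.
  apply: has_mean_eq (has_mean_cst 0); last by rewrite big_ord0.
  by move=> x; rewrite big_ord0.
apply: has_mean_eq (has_meanD (fa ord0) (IH _ _ (fun i => fa (lift ord0 i)))).
  by move=> x; rewrite big_ord_recl.
by rewrite big_ord_recl.
Qed.

Lemma has_mean_bounded f k : measurable_fun setT f -> (forall x, `|f x| <= k) ->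
  has_mean f (\int[P]_x f x).
Proof.
move=> mf fk; apply: has_mean_integrable.
have [ci _] := has_mean_cst k; apply: le_integrable ci => //.
  exact/measurable_EFinP.
by move=> x _ /=; rewrite lee_fin (le_trans (fk x))// ler_norm.
Qed.

End HasMean.

(** * Trigonometric, exponential and polynomial means of a linear form *)

Section CompoundPoissonMeans.
Context {R : realType} {d : nat}.
Local Notation T := (d.-tuple R).
Variables (J : probability T R) (t : 'rV[R]_d).
Implicit Types (b : T) (l : {nonneg R}) (c : R).

Lemma measurable_shift_vdot c : measurable_fun setT (fun x : T => c + vdot t x).
Proof. by apply: measurable_funD => //; exact: measurable_vdot. Qed.

Lemma measurable_cos_vdot c : measurable_fun setT (fun x : T => cos (c + vdot t x)).
Proof.
apply: (@measurableT_comp _ _ _ _ _ _ cos); last exact: measurable_shift_vdot.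
by apply: continuous_measurable_fun; exact: continuous_cos.
Qed.

Lemma measurable_sin_vdot c : measurable_fun setT (fun x : T => sin (c + vdot t x)).
Proof.
apply: (@measurableT_comp _ _ _ _ _ _ sin); last exact: measurable_shift_vdot.
by apply: continuous_measurable_fun; exact: continuous_sin.
Qed.

Lemma measurable_expR_vdot c :
  measurable_fun setT (fun x : T => expR (c + vdot t x)).
Proof.
by apply: (@measurableT_comp _ _ _ _ _ _ (@expR R)) => //;
  exact: measurable_shift_vdot.
Qed.

Lemma measurable_sqr_vdot c :
  measurable_fun setT (fun x : T => (c + vdot t x) ^+ 2).
Proof. by apply: measurable_funX; exact: measurable_shift_vdot. Qed.

(** Here g n c plays the role of E h(c + t.(Y_1 + ... + Y_n)), and the last hypothesis is the
    recursion obtained by conditioning on one jump. The offset c stays general because it absorbs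
    that jump in the induction. *)
Lemma integral_convn_vdot (h : R -> R) (g : nat -> R -> R) :
  (forall c, measurable_fun setT (fun x : T => h (c + vdot t x))) ->
  (forall s, 0 <= h s) ->
  (forall c, h c = g 0%N c) ->
  (forall n c, \int[J]_x (g n (c + vdot t x))%:E = (g n.+1 c)%:E)%E ->
  forall n c, (\int[convn J n]_y (h (c + vdot t y))%:E = (g n c)%:E)%E.
Proof.
move=> mh h0 g0 gS; have mF c : measurable_fun setT
    (fun x : T => (h (c + vdot t x))%:E) by exact/measurable_EFinP.
elim=> [|n IH] c.
  by rewrite integral_dirac//= diracT mul1e vdot_vzero addr0 g0.
rewrite convnS ge0_integral_conv//; last by move=> x; rewrite lee_fin.
rewrite -gS; apply: eq_integral => x _; rewrite -IH.
by apply: eq_integral => y _; rewrite vdot_vadd addrA.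
Qed.

Lemma integral_cpois_vdot b l (h : R -> R) (g : nat -> R -> R) c (L : R) :
  (forall c, measurable_fun setT (fun x : T => h (c + vdot t x))) ->
  (forall s, 0 <= h s) ->
  (forall c, h c = g 0%N c) ->
  (forall n c, \int[J]_x (g n (c + vdot t x))%:E = (g n.+1 c)%:E)%E ->
  series (fun n => poisson_weight l%:num n * g n (c + l%:num * vdot t b))
    @ \oo --> L ->
  (\int[cpois b l J]_x (h (c + vdot t x))%:E = L%:E)%E.
Proof.
move=> mh h0 g0 gS gL.
apply: (integral_cpois_EFin (g := fun n => g n (c + l%:num * vdot t b))) => // n.
rewrite -(integral_convn_vdot mh h0 g0 gS); apply: eq_integral => y _.
by rewrite vdot_vadd vdot_vscale addrA.
Qed.

Definition jump_charfun : R[i] :=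
  Complex (\int[J]_x cos (vdot t x)) (\int[J]_x sin (vdot t x)).

Lemma has_mean_cos : has_mean J (fun x => cos (vdot t x)) (complex.Re jump_charfun).
Proof.
apply: (@has_mean_bounded _ _ _ _ _ 1).
  by have := measurable_cos_vdot 0; under eq_fun do rewrite add0r.
by move=> x; rewrite ler_norml cos_geN1 cos_le1.
Qed.

Lemma has_mean_sin : has_mean J (fun x => sin (vdot t x)) (complex.Im jump_charfun).
Proof.
apply: (@has_mean_bounded _ _ _ _ _ 1).
  by have := measurable_sin_vdot 0; under eq_fun do rewrite add0r.
by move=> x; rewrite ler_norml sin_geN1 sin_le1.
Qed.

(** The free phase c lets one computation serve for the real part (c = 0) and the imaginary part (c
    = -pi/2) of the characteristic function. *)
Lemma has_mean_cpois_cos b l c :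
  has_mean (cpois b l J) (fun x => cos (c + vdot t x))
    (expR (l%:num * (complex.Re jump_charfun - 1)) *
     cos (c + l%:num * vdot t b + l%:num * complex.Im jump_charfun)).
Proof.
set L := (X in has_mean _ _ X).
suff cosL : has_mean (cpois b l J) (fun x => 1 + cos (c + vdot t x)) (1 + L).
  apply: has_mean_eq (has_meanD cosL (has_mean_cst _ (-1))).
    by move=> x /=; rewrite addrAC subrr add0r.
  by rewrite addrAC subrr add0r.
have cos0 s : 0 <= 1 + cos s :> R by rewrite -lerBlDl sub0r cos_geN1.
have mcos e : measurable_fun setT (fun x : T => 1 + cos (e + vdot t x)).
  by apply: measurable_funD => //; exact: measurable_cos_vdot.
apply: has_mean_ge0 => //.
(* g n e = 1 + Re(e^(ie) z^n) is the mean of 1 + cos(e + t.S_n) for a sum S_n of n independent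
   jumps. *)
pose z := jump_charfun; pose g n e := 1 + (cos e * complex.Re (z ^+ n) -
  sin e * complex.Im (z ^+ n)) : R.
apply: (@integral_cpois_vdot _ _ (fun s => 1 + cos s) g) => //.
- by move=> e; rewrite /g expr0/= mulr1 mulr0 subr0.
- move=> n e; have [_ <-] // : has_mean J (fun x => g n (e + vdot t x)) (g n.+1 e).
  apply: has_mean_eq (has_meanD (has_mean_cst J 1) (has_meanD
    (has_meanZ (cos e * complex.Re (z ^+ n) - sin e * complex.Im (z ^+ n)) has_mean_cos)
    (has_meanZ (- (sin e * complex.Re (z ^+ n) + cos e * complex.Im (z ^+ n)))
      has_mean_sin))).
    by move=> x; rewrite /g cosD sinD /=; ring.
  by rewrite /g exprS complexReM complexImM -/z; ring.
- exact: cvg_series_poisson_cos.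
Qed.

Lemma integral_cpois_expR b l c (M : R) :
  (\int[J]_x (expR (vdot t x))%:E = M%:E)%E ->
  (\int[cpois b l J]_x (expR (c + vdot t x))%:E =
   (expR (c + l%:num * vdot t b + l%:num * (M - 1)))%:E)%E.
Proof.
move=> JM.
have M_mean : has_mean J (fun x => expR (vdot t x)) M.
  apply: has_mean_ge0 => //.
  by have := measurable_expR_vdot 0; under eq_fun do rewrite add0r.
apply: (@integral_cpois_vdot _ _ (@expR R) (fun n e => expR e * M ^+ n)) => //.
- exact: measurable_expR_vdot.
- by move=> e; rewrite expr0 mulr1.
- move=> n e.
  have [_ <-] // : has_mean J (fun x => expR (e + vdot t x) * M ^+ n)
    (expR e * M ^+ n.+1).
  apply: has_mean_eq (has_meanZ (expR e * M ^+ n) M_mean).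
    by move=> x; rewrite expRD; ring.
  by rewrite exprSr mulrA.
- rewrite [expR (_ + l%:num * (M - 1))]expRD; rewrite (_ : series _ =
    fun n => expR (c + l%:num * vdot t b) *
    series (fun n => poisson_weight l%:num n * M ^+ n) n).
    have := @cvg_series_poisson_exp R l%:num M.
    exact: (cvgM (cvg_cst _)).
  apply/funext => n; rewrite /series/= [RHS]mulr_sumr.
  by apply: eq_bigr => i _; rewrite mulrCA.
Qed.

(** The term with exactly one jump has positive weight, as the rate is positive, and is already
    infinite. *)
Lemma integral_cpois_expR_infinite b l : 0 < l%:num ->
  (\int[J]_x (expR (vdot t x))%:E = +oo)%E ->
  (\int[cpois b l J]_x (expR (vdot t x))%:E = +oo)%E.
Proof.
move=> l0 Joo.
have mexp : measurable_fun setT (fun x : T => (expR (vdot t x))%:E).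
  apply/measurable_EFinP.
  by have := measurable_expR_vdot 0; under eq_fun do rewrite add0r.
have exp0 (x : T) : (0 <= (expR (vdot t x))%:E)%E by rewrite lee_fin expR_ge0.
rewrite ge0_integral_cpois//; apply: (@nneseries_pinfty _ _ _ 1%N) => //.
  move=> n _; apply: mule_ge0; first by rewrite lee_fin poisson_weight_ge0.
  exact: integral_ge0.
rewrite (_ : integral _ _ _ = +oo%E).
  rewrite gt0_muley// lte_fin mulr_gt0 ?expR_gt0//.
  by rewrite /exp_coeff/= divr1 expr1.
rewrite convnS ge0_integral_conv//; last exact: (measurable_vaddF _ mexp).
transitivity (\int[J]_x ((expR (l%:num * vdot t b))%:E * (expR (vdot t x))%:E))%E.
  apply: eq_integral => x _; rewrite integral_dirac//=; last first.
    exact: (measurable_vaddF x (measurable_vaddF _ mexp)).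
  rewrite diracT mul1e !vdot_vadd vdot_vscale vdot_vzero addr0.
  by rewrite expRD EFinM.
by rewrite ge0_integralZl// Joo gt0_muley// lte_fin expR_gt0.
Qed.

Section SecondMoment.
Variables m v : R.
Hypothesis mJ : has_mean J (vdot t) m.
Hypothesis vJ : has_mean J (fun x => vdot t x ^+ 2) v.

Lemma has_mean_cpois_sqr b l c :
  has_mean (cpois b l J) (fun x => (c + vdot t x) ^+ 2)
    ((c + l%:num * (vdot t b + m)) ^+ 2 + l%:num * v).
Proof.
apply: has_mean_ge0; [exact: measurable_sqr_vdot|by move=> x; exact: sqr_ge0|].
(* This is E (e + S_n)^2 for S_n a sum of n independent variables with mean m and second moment v: n
   squares contribute v each, and n(n - 1) ordered cross pairs m^2 each. *)
pose g n e := e ^+ 2 + (e * m *+ 2 + v) * n%:R + m ^+ 2 * (n%:R * (n%:R - 1)) : R.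
apply: (@integral_cpois_vdot _ _ (fun s => s ^+ 2) g) => //.
- exact: measurable_sqr_vdot.
- by move=> s; exact: sqr_ge0.
- by move=> e; rewrite /g mulr0 mul0r mulr0 !addr0.
- move=> n e; have [_ <-] // : has_mean J (fun x => g n (e + vdot t x)) (g n.+1 e).
  apply: has_mean_eq (has_meanD (has_mean_cst J (g n e)) (has_meanD
    (has_meanZ (e *+ 2 + m *+ 2 * n%:R) mJ) vJ)).
    by move=> x; rewrite /g /=; ring.
  by rewrite /g -natr1; ring.
- rewrite (_ : _ + _ = (c + l%:num * vdot t b) ^+ 2 +
      ((c + l%:num * vdot t b) * m *+ 2 + v) * l%:num + m ^+ 2 * l%:num ^+ 2).
    exact: cvg_series_poisson_quadratic.
  by ring.
Qed.

(** From y = ((1 + y)^2 - y^2 - 1) / 2: both squares are nonnegative integrands with known means. *)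
Lemma has_mean_cpois b l :
  has_mean (cpois b l J) (vdot t) (l%:num * (vdot t b + m)).
Proof.
apply: has_mean_eq (has_meanZ (2^-1) (has_meanD (has_mean_cpois_sqr b l 1)
  (has_meanD (has_meanZ (-1) (has_mean_cpois_sqr b l 0)) (has_mean_cst _ (-1))))).
  by move=> x /=; field.
by field.
Qed.

End SecondMoment.

End CompoundPoissonMeans.

(** * The centered compound Poisson vector with a given jump law *)

Section SecondMoments.
Context {R : realType} {d : nat}.
Local Notation T := (d.-tuple R).
Variable P : probability T R.
Hypothesis P2 : P.-integrable setT (fun x : T => (sqnorm x)%:E).
Implicit Types (t : 'rV[R]_d) (x : T).

Lemma sqr_tnth_le_sqnorm x i : tnth x i ^+ 2 <= sqnorm x.
Proof.
by rewrite /sqnorm (bigD1 i)//= lerDl; apply: sumr_ge0 => j _; exact: sqr_ge0.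
Qed.

Lemma sqnorm_ge0 x : 0 <= sqnorm x.
Proof. by apply: sumr_ge0 => i _; exact: sqr_ge0. Qed.

Lemma has_mean_le_sqnorm (f : T -> R) : measurable_fun setT f ->
  (forall x, `|f x| <= 1 + sqnorm x) -> has_mean P f (\int[P]_x f x).
Proof.
move=> mf fle; apply: has_mean_integrable.
have [c1 _] := has_meanD (has_mean_cst P 1) (has_mean_integrable P2).
apply: le_integrable c1 => //; first exact/measurable_EFinP.
by move=> x _ /=; rewrite lee_fin (le_trans (fle x))// ler_norm.
Qed.

Lemma has_mean_tnth i : has_mean P (fun x => tnth x i) (\int[P]_x tnth x i).
Proof.
apply: has_mean_le_sqnorm; first exact: measurable_tnth.
move=> x; apply: le_trans (_ : 1 + tnth x i ^+ 2 <= _); last first.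
  by rewrite lerD2l sqr_tnth_le_sqnorm.
by rewrite ler_norml; apply/andP; split; nra.
Qed.

(** Uncentered second moments. For the jump law this is the covariance matrix of the compound
    Poisson vector of rate 1, to which jumps contribute E[Y Y^T] rather than their own
    covariance. *)
Definition moment_mx : 'M[R]_d := \matrix_(i, j) \int[P]_x (tnth x i * tnth x j).

Lemma has_mean_tnthM i j :
  has_mean P (fun x => tnth x i * tnth x j) (moment_mx i j).
Proof.
rewrite mxE; apply: has_mean_le_sqnorm.
  by apply: measurable_funM; exact: measurable_tnth.
move=> x; have := sqr_tnth_le_sqnorm x i; have := sqr_tnth_le_sqnorm x j.
by move=> hj hi; rewrite ler_norml; apply/andP; split; nra.
Qed.

Lemma has_mean_vdot t :
  has_mean P (vdot t) (\sum_(i < d) t 0 i * \int[P]_x tnth x i).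
Proof. exact: has_mean_sum (fun i => has_meanZ (t 0 i) (has_mean_tnth i)). Qed.

Lemma qformE (A : 'M[R]_d) t :
  qform A t = \sum_(i < d) \sum_(j < d) (t 0 i * t 0 j) * A i j.
Proof.
rewrite /qform mxE exchange_big/=; apply: eq_bigr => j _.
rewrite !mxE mulr_suml; apply: eq_bigr => i _; ring.
Qed.

Lemma has_mean_sqr_vdot t :
  has_mean P (fun x => vdot t x ^+ 2) (qform moment_mx t).
Proof.
rewrite qformE; apply: has_mean_eq (has_mean_sum (fun i => has_mean_sum
  (fun j => has_meanZ (t 0 i * t 0 j) (has_mean_tnthM i j)))) => // x.
rewrite expr2 /vdot big_distrlr/=; apply: eq_bigr => i _.
by apply: eq_bigr => j _; ring.
Qed.

End SecondMoments.

(** * Centering, covariance, Lévy triplet and radial pole at rate 1 *)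

Section CenteredCompoundPoisson.
Context {R : realType} {d : nat}.
Local Notation T := (d.-tuple R).
Variable J : probability T R.
Hypothesis J2 : J.-integrable setT (fun x : T => (sqnorm x)%:E).
Hypothesis J0 : J [set vzero] = 0%E.
Implicit Types (t : 'rV[R]_d) (x : T).

(** The random vector will be the identity on the space that carries its own law, so its
    expectations are integrals against [ccp_law]. *)
Definition tuple_id : T -> T := idfun.

HB.instance Definition _ :=
  isMeasurableFun.Build _ _ _ _ tuple_id (@measurable_id _ _ setT).

Definition ccp_drift : T := [tuple - \int[J]_x tnth x i | i < d].

Definition ccp_law : probability T R := cpois ccp_drift 1%:nng J.

Definition ccp : {RV ccp_law >-> T} := tuple_id.

Lemma vdot_drift t :
  vdot t ccp_drift = - \sum_(i < d) t 0 i * \int[J]_x tnth x i.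
Proof.
by rewrite /vdot -sumrN; apply: eq_bigr => i _; rewrite tnth_mktuple mulrN.
Qed.

Lemma has_mean_ccp t : has_mean ccp_law (vdot t) 0.
Proof.
apply: has_mean_eq (has_mean_cpois (has_mean_vdot J2 t) (has_mean_sqr_vdot J2 t)
  ccp_drift 1%:nng) => //.
by rewrite vdot_drift addNr mulr0.
Qed.

Lemma has_mean_ccp_sqr t :
  has_mean ccp_law (fun x => vdot t x ^+ 2) (qform (moment_mx J) t).
Proof.
apply: has_mean_eq (has_mean_cpois_sqr (has_mean_vdot J2 t) (has_mean_sqr_vdot J2 t)
  ccp_drift 1%:nng 0) => //.
  by move=> x; rewrite add0r.
by rewrite vdot_drift addNr mulr0 addr0 expr0n/= add0r mul1r.
Qed.

Lemma vdot_delta i x : vdot (delta_mx 0 i) x = tnth x i.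
Proof.
rewrite /vdot (bigD1 i)//= mxE !eqxx mul1r big1 ?addr0// => j ji.
by rewrite mxE eqxx (negbTE ji) mul0r.
Qed.

Lemma integrable_sqnorm_ccp : ccp_law.-integrable setT (fun x : T => (sqnorm x)%:E).
Proof.
have [+ _] := has_mean_sum (fun i => has_mean_ccp_sqr (delta_mx 0 i)).
apply: eq_integrable => // x _ /=; congr (_%:E).
by apply: eq_bigr => i _; rewrite vdot_delta.
Qed.

Lemma expectation_coord_ccp i : ('E_(ccp_law)[Defs.coord ccp i] = 0)%E.
Proof.
rewrite unlock; have [_ /(eq_trans _)] := has_mean_ccp (delta_mx 0 i); apply.
by apply: eq_integral => x _; rewrite vdot_delta.
Qed.

Lemma covmx_ccp : covmx ccp = moment_mx ccp_law.
Proof.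
apply/matrixP => i j; rewrite !mxE; congr fine.
rewrite unlock !expectation_coord_ccp unlock/=.
apply: eq_integral => x _.
by transitivity ((tnth x i - 0) * (tnth x j - 0))%:E => //; rewrite !subr0.
Qed.

(** E <t, X>^2 is computed twice, from the moments of [ccp_law] and from those of the jump law J. *)
Lemma variance_form_ccp t : variance_form ccp t = qform (moment_mx J) t.
Proof.
rewrite /variance_form covmx_ccp.
have [_ +] := has_mean_sqr_vdot integrable_sqnorm_ccp t.
by have [_ ->] := has_mean_ccp_sqr t => -[].
Qed.

(** The second summand cancels the compensator <t, x> 1_{|x| <= 1} in [levy_exponent], leaving the
    centering shift as the only linear term. *)
Definition levy_drift : 'rV[R]_d := \row_(i < d)
  (tnth ccp_drift i + \int[J]_x (if sqnorm x <= 1 then tnth x i else 0)).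

Lemma has_mean_truncated_vdot t :
  has_mean J (fun x => if sqnorm x <= 1 then vdot t x else 0)
   (\sum_(i < d) t 0 i * \int[J]_x (if sqnorm x <= 1 then tnth x i else 0)).
Proof.
apply: has_mean_eq (has_mean_sum (fun i => has_meanZ (t 0 i)
  (@has_mean_bounded _ _ _ J
    (fun x => if sqnorm x <= 1 then tnth x i else 0) 1 _ _))) => //.
- move=> x; case: ifP => // _; by rewrite big1// => i _; rewrite mulr0.
- move=> i; apply: measurable_fun_ifT => //; last exact: measurable_tnth.
  by apply: measurable_fun_ler => //; exact: measurable_sqnorm.
- move=> i x; case: ifP => [x1|_]; last by rewrite normr0.
  rewrite -[leRHS]ger0_norm// -ler_sqr ?nnegrE// -normrX -normrX expr1n.
  by rewrite !ger0_norm ?sqr_ge0//; exact: le_trans (sqr_tnth_le_sqnorm x i) x1.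
Qed.

(** At rate 1 the Lévy measure is J itself. Real and imaginary parts both come from
    [has_mean_cpois_cos], the sine being a cosine shifted by pi/2. *)
Lemma charfun_ccp t : charfun ccp t = cexp (levy_exponent levy_drift 0 J t).
Proof.
have sinE s : sin s = cos (- (pi / 2) + s) :> R.
  by rewrite addrC cosB cos_pihalf sin_pihalf mulr0 add0r mulr1.
rewrite /charfun /levy_exponent /cexp.
have -> : qform 0 t = 0 by rewrite /qform mulmx0 mul0mx mxE.
rewrite mul0r oppr0 add0r.
have -> : \int[J]_x (cos (vdot t x) - 1) = complex.Re (jump_charfun J t) - 1.
  exact: has_mean_Rintegral (has_meanD (has_mean_cos J t) (has_mean_cst J (-1))).
have -> : \sum_(i < d) levy_drift 0 i * t 0 i + \int[J]_x (sin (vdot t x) -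
    (if sqnorm x <= 1 then vdot t x else 0)) =
    vdot t ccp_drift + complex.Im (jump_charfun J t).
  have/has_mean_Rintegral := has_meanD (has_mean_sin J t)
    (has_meanZ (-1) (has_mean_truncated_vdot t)).
  under eq_Rintegral do rewrite mulN1r.
  move=> ->; rewrite (_ : \sum_(i < d) levy_drift 0 i * t 0 i =
    vdot t ccp_drift +
    \sum_(i < d) t 0 i * \int[J]_x (if sqnorm x <= 1 then tnth x i else 0)).
    by ring.
  rewrite /vdot -big_split/=.
  by apply: eq_bigr => i _; rewrite mxE mulrDl ![_ * t 0 i]mulrC.
set a := _ - 1; set y := vdot t _ + _.
have mean_cos c : has_mean ccp_law (fun x => cos (c + vdot t x))
    (expR a * cos (c + y)).
  apply: has_mean_eq (has_mean_cpois_cos J t ccp_drift 1%:nng c) => //.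
  by rewrite !mul1r addrA.
rewrite unlock; congr Complex.
  have [_ +] := mean_cos 0; rewrite add0r.
  by under eq_integral do rewrite add0r; move=> ->.
have [_ +] := mean_cos (- (pi / 2)); rewrite -sinE.
by under eq_integral do rewrite -sinE; move=> ->.
Qed.

Lemma levy_measure_ccp : levy_measure J.
Proof.
split=> //; apply: (@le_lt_trans _ _ (\int[J]_x (cst 1%:E) x)%E).
  apply: ge0_le_integral => //.
  - by move=> x _; rewrite lee_fin le_min ler01 sqnorm_ge0.
  - apply/measurable_EFinP; apply: measurable_minr => //.
    exact: measurable_sqnorm.
  - by move=> x _; rewrite lee_fin ge_min lexx.
rewrite integral_cst//.
by rewrite mul1e [X in (X < _)%E](@probability_setT _ _ _ J) ltry.
Qed.

Lemma centered_compound_poisson_ccp : centered_compound_poisson ccp.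
Proof.
split.
- exact: infinitely_divisible_cpois.
- exists levy_drift, J; split; last first.
    by rewrite [X in (X < _)%E](@probability_setT _ _ _ J) ltry.
  split; [|exact: levy_measure_ccp|exact: charfun_ccp].
  by split=> [|t]; [rewrite trmx0|rewrite /qform mulmx0 mul0mx mxE].
- split; last exact: expectation_coord_ccp.
  have msqrt : measurable_fun setT (fun x : T => Num.sqrt (sqnorm x)).
    apply: (@measurableT_comp _ _ _ _ _ _ (@Num.sqrt R)).
      by apply: continuous_measurable_fun; exact: sqrt_continuous.
    exact: measurable_sqnorm.
  apply: (proj1 (has_mean_le_sqnorm integrable_sqnorm_ccp msqrt _)) => x.
  rewrite ger0_norm ?sqrtr_ge0//.
  by have := sqr_sqrtr (sqnorm_ge0 x); set r := Num.sqrt _ => <-; nra.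
Qed.

Lemma finite_second_moment_ccp : finite_second_moment ccp.
Proof.
rewrite /finite_second_moment unlock; have := integrable_sqnorm_ccp.
by move=> /integrable_lty; apply.
Qed.

Lemma pdmx_covmx_ccp : (forall t, t != 0 -> 0 < qform (moment_mx J) t) ->
  pdmx (covmx ccp).
Proof.
move=> J_gt0; split=> [|t t0]; last first.
  by have := variance_form_ccp t; rewrite /variance_form => ->; exact: J_gt0.
rewrite covmx_ccp; apply/matrixP => i j; rewrite !mxE.
by apply: eq_Rintegral => x _; rewrite mulrC.
Qed.

Lemma radial_pole_infinite t : 0 < qform (moment_mx J) t ->
  (forall s : R, 0 < s -> (\int[J]_x (expR (s * vdot t x))%:E = +oo)%E) ->
  radial_pole ccp t = +oo%E.
Proof.
move=> vt expoo; rewrite /radial_pole variance_form_ccp vt.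
rewrite (_ : [set c%:E | c in _] = set0) ?ereal_inf0//.
apply/seteqP; split=> // x [c [c0 Kc] _].
(* The test point s = 1/(c + 1) lies below 1/c for every c >= 0, also for c = 0 where 1/c = +oo.
   There the cumulant is infinite, so no real c is admissible and the infimum runs over the empty
   set. *)
have s0 : 0 < (c + 1)^-1 by rewrite invr_gt0 ltr_wpDl.
have /Kc : (((c + 1)^-1)%:E < (c%:E)^-1)%E.
  rewrite inver; case: eqVneq => [_|c_neq0]; first by rewrite ltry.
  have c_gt0 : 0 < c by rewrite lt_def c_neq0.
  by rewrite lte_fin ltf_pV2 ?posrE ?ltrDl// addr_gt0.
move=> /(_ (ltW s0)); rewrite /cumulant unlock.
rewrite (_ : integral _ _ _ = +oo%E) ?leye_eq//.
apply: integral_cpois_expR_infinite => //.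
by under eq_integral do rewrite vdotZ; exact: expoo.
Qed.

End CenteredCompoundPoisson.

(** * The jump law on the points (-1, 2^k) *)

(** Since e^s >= 1 + s + s^2/2, it suffices that (1 + s + s^2/2)(1 - s + s^2/2) >= 1, and this
    product is 1 + s^4/4. *)
Lemma expRN_le_quadratic {R : realType} (s : R) : 0 <= s ->
  expR (- s) <= 1 - s + s ^+ 2 / 2.
Proof.
move=> s0.
have exp_ge : 1 + s + s ^+ 2 / 2 <= expR s.
  have <- : series (exp_coeff s) 3 = 1 + s + s ^+ 2 / 2.
    rewrite /series/= !big_nat_recr//= big_geq// /exp_coeff/=.
    by rewrite !fact0 expr0 expr1 !divr1 add0r.
  rewrite /expR; apply: nondecreasing_cvgn_le; last exact: is_cvg_series_exp_coeff.
  apply/nondecreasing_seqP => n; rewrite /series/= big_nat_recr//= lerDl.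
  exact: exp_coeff_ge0.
have E : expR s * expR (- s) = 1 by exact: expRxMexpNx_1.
have e0 := expR_ge0 (- s).
have p0 : 0 < 1 + s + s ^+ 2 / 2 by nra.
rewrite -(ler_pM2l p0); apply: le_trans (_ : 1 <= _).
  by have := ler_wpM2r e0 exp_ge; rewrite E.
suff : 1 <= (1 + s + s ^+ 2 / 2) * (1 - s + s ^+ 2 / 2) by [].
rewrite (_ : (_ * _) = 1 + (s ^+ 2 / 2) ^+ 2); last by field.
by rewrite lerDl sqr_ge0.
Qed.

(** The hypothesis says that c = 0 is admissible, and all admissible c are nonnegative. *)
Lemma radial_pole0 {R : realType} {d : nat} {disp} {Omega : measurableType disp}
    (P : probability Omega R) (X : {RV P >-> d.-tuple R}) (t : 'rV[R]_d) :
  (forall s : R, 0 <= s ->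
    (cumulant X (s *: t) <= (variance_form X t * s ^+ 2 / 2)%:E)%E) ->
  radial_pole X t = 0%E.
Proof.
move=> Kle; rewrite /radial_pole; case: ifPn => // _.
apply/eqP; rewrite eq_le; apply/andP; split.
  apply: ereal_inf_lbound; exists 0 => //; split=> // s s0 _.
  by rewrite mul0r subr0 mulr1; exact: Kle.
by apply: le_ereal_inf_tmp => _ [c [c0 _] <-]; rewrite lee_fin.
Qed.

Lemma nneseries_ge_cst {R : realType} (u : nat -> \bar R) (k : R) : 0 < k ->
  (forall n, k%:E <= u n)%E -> (\sum_(n <oo) u n = +oo)%E.
Proof.
move=> k0 ku; have u0 n : (0 <= u n)%E.
  by apply: le_trans (ku n); rewrite lee_fin ltW.
(* More than A / k terms, each at least k, sum to at least A. *)
apply/eqyP => A A0; pose n := (Num.truncn (A / k)).+1.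
apply: le_trans (nneseries_lim_ge n _) => //.
apply: (@le_trans _ _ (\sum_(0 <= i < n) k%:E)%E); last first.
  by apply: lee_sum => i _; exact: ku.
rewrite sumEFin lee_fin sumr_const_nat subn0 -mulr_natr -ler_pdivrMl// mulrC.
by rewrite ltW// truncnS_gt.
Qed.

Section Example.
Context {R : realType}.
Local Notation T := (2.-tuple R).
Implicit Types (t : 'rV[R]_2) (k : nat).

Let y0 : 'I_2 := ord0.
Let y1 : 'I_2 := lift ord0 ord0.

Definition jump k : T := [tuple -1; 2 ^+ k].

(** The ratio 1/8 makes 8^-k (2^k)^2 = 2^-k summable while 8^-k (2^k)^3 = 1 is not; 7/8 normalizes
    the total mass. *)
Definition jump_weight k : R := 7 / 8 * (8^-1) ^+ k.

Lemma jump_weight_ge0 k : 0 <= jump_weight k.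
Proof. by rewrite mulr_ge0// exprn_ge0. Qed.

Let jump_term k : {measure set T -> \bar R} :=
  mscale (NngNum (jump_weight_ge0 k)) \d_(jump k).

Definition jump_law : set T -> \bar R := mseries jump_term 0.

HB.instance Definition _ := Measure.on jump_law.

Lemma vdot_jump t k : vdot t (jump k) = t 0 y1 * 2 ^+ k - t 0 y0.
Proof. by rewrite /vdot !big_ord_recl big_ord0 !(tnth_nth 0)/= addr0 mulrN1 addrC. Qed.

Lemma sqnorm_jump k : sqnorm (jump k) = 1 + (2 ^+ k) ^+ 2.
Proof.
by rewrite /sqnorm !big_ord_recl big_ord0 !(tnth_nth 0)/= addr0 sqrrN expr1n.
Qed.

Lemma cvg_series_geometric (a r l : R) : `|r| < 1 -> a = l * (1 - r) ->
  series (fun k => a * r ^+ k) @ \oo --> l.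
Proof.
move=> r1 ->; have r0 : 1 - r != 0.
  by rewrite subr_eq0 eq_sym lt_eqF// (le_lt_trans (ler_norm _)).
by rewrite -[X in _ --> X](mulfK r0); exact: cvg_geometric_series.
Qed.

Lemma sum_jump_weight : (\sum_(k <oo) (jump_weight k)%:E = 1)%E.
Proof.
apply: eseries_EFin; apply: cvg_series_geometric; last by field.
by rewrite ger0_norm; lra.
Qed.

Let jump_law_setT : jump_law setT = 1%E.
Proof.
rewrite -sum_jump_weight; apply: eq_eseriesr => k _.
by rewrite -[RHS]mule1; congr (_ * _)%E; exact: probability_setT.
Qed.

HB.instance Definition _ :=
  Measure_isProbability.Build _ _ _ jump_law jump_law_setT.

Lemma ge0_integral_jump_law (f : T -> R) : measurable_fun setT f ->
  (forall x, 0 <= f x) ->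
  (\int[jump_law]_x (f x)%:E = \sum_(k <oo) (jump_weight k * f (jump k))%:E)%E.
Proof.
move=> mf f0; have mF : measurable_fun setT (EFin \o f) by exact/measurable_EFinP.
have F0 (x : T) : (0 <= (f x)%:E)%E by rewrite lee_fin.
rewrite /jump_law ge0_integral_measure_series//.
apply: eq_eseriesr => k _.
rewrite ge0_integral_mscale//.
rewrite integral_dirac// diracT mul1e.
by rewrite -EFinM.
Qed.

Lemma jump_law_vzero : jump_law [set vzero] = 0%E.
Proof.
apply: eseries0 => k _ _; rewrite /jump_term /= /mscale/= diracE memNset ?mule0//.
move=> /(congr1 (fun x => tnth x y0)); rewrite /vzero tnth_mktuple (tnth_nth 0)/=.
by move/eqP; rewrite oppr_eq0 oner_eq0.
Qed.

Lemma integrable_sqnorm_jump_law :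
  (jump_law : probability T R).-integrable setT (fun x : T => (sqnorm x)%:E).
Proof.
(* The second moment is the sum of (7/8) 8^-k (1 + 4^k), that is 1 + (7/8) 2 = 1 + 7/4. *)
apply: (proj1 (@has_mean_ge0 _ _ _ (jump_law : probability T R) _ (1 + 7 / 4) _ _ _)).
- exact: measurable_sqnorm.
- exact: sqnorm_ge0.
rewrite ge0_integral_jump_law//; [|exact: measurable_sqnorm|exact: sqnorm_ge0].
apply: eseries_EFin.
rewrite (_ : series _ = (fun n => series (fun k => 7 / 8 * (8^-1) ^+ k) n +
    series (fun k => 7 / 8 * (2^-1) ^+ k) n)).
  apply: cvgD; apply: cvg_series_geometric; try by field.
    by rewrite ger0_norm; lra.
  by rewrite ger0_norm; lra.
apply/funext => n; rewrite /series/= -big_split/=; apply: eq_bigr => k _.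
have e : (8^-1) ^+ k * (2 ^+ k) ^+ 2 = (2^-1) ^+ k :> R.
  by rewrite -exprM mulnC exprM -exprMn; congr (_ ^+ _); field.
by rewrite sqnorm_jump /jump_weight mulrDr mulr1 -[X in _ + X]mulrA e.
Qed.

Let V t : R := qform (moment_mx (jump_law : probability T R)) t.

Let sqr_vdot_jump_law t :
  (\sum_(k <oo) (jump_weight k * vdot t (jump k) ^+ 2)%:E = (V t)%:E)%E.
Proof.
rewrite -(proj2 (has_mean_sqr_vdot integrable_sqnorm_jump_law t)).
rewrite (ge0_integral_jump_law (f := fun x => vdot t x ^+ 2))//.
  by apply: measurable_funX; exact: measurable_vdot.
by move=> x; exact: sqr_ge0.
Qed.

Lemma jump_law_nondegenerate t : t != 0 -> 0 < V t.
Proof.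
(* The jumps (-1, 1) and (-1, 2), of weights 7/8 and 7/64, already span the plane, so the first two
   terms of the series suffice. *)
move=> t0; have V_ge : 7 / 8 * (t 0 y1 - t 0 y0) ^+ 2 +
    7 / 64 * (t 0 y1 * 2 - t 0 y0) ^+ 2 <= V t.
  rewrite -lee_fin -sqr_vdot_jump_law; apply: le_trans (nneseries_lim_ge 2 _).
    rewrite !big_nat_recr//= big_geq// add0e -EFinD lee_fin !vdot_jump /jump_weight.
    rewrite !expr0 !expr1 !mulr1 lerD2l ler_wpM2r ?sqr_ge0//; lra.
  by move=> k _ _; rewrite lee_fin mulr_ge0 ?jump_weight_ge0 ?sqr_ge0.
rewrite ltNge; apply: contra_neqN t0 => V_le0.
have sqr_le0 (x : R) : x ^+ 2 <= 0 -> x = 0.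
  by rewrite le_eqVlt ltNge sqr_ge0 orbF sqrf_eq0 => /eqP.
have := sqr_ge0 (t 0 y1 - t 0 y0); have := sqr_ge0 (t 0 y1 * 2 - t 0 y0) => h1 h2.
have /sqr_le0 e1 : (t 0 y1 - t 0 y0) ^+ 2 <= 0 by lra.
have /sqr_le0 e2 : (t 0 y1 * 2 - t 0 y0) ^+ 2 <= 0 by lra.
have [t00 t01] : t 0 y0 = 0 /\ t 0 y1 = 0 by split; lra.
apply/rowP => i; rewrite mxE.
by case: (unliftP ord0 i) => [j ->|-> //]; rewrite ord1.
Qed.

Let u0 : 'rV[R]_2 := delta_mx 0 y0.

Let vdot_u0_jump k : vdot u0 (jump k) = -1.
Proof. by rewrite vdot_jump !mxE/= mul0r sub0r. Qed.

Let V_u0 : V u0 = 1.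
Proof.
apply: EFin_inj; rewrite -sqr_vdot_jump_law -sum_jump_weight.
by apply: eq_eseriesr => k _; rewrite vdot_u0_jump sqrrN expr1n mulr1.
Qed.

(** The form <u_0, x> is -1 at all jumps, so the nonnegative integrand (1 + <u_0, x>)^2 has mean 0.
    Expanding it gives 1 + 2m + 1 = 0 for the mean m. *)
Let mean_u0 : \sum_(i < 2) u0 0 i * \int[jump_law]_x tnth x i = -1.
Proof.
set m := LHS.
have [_] := has_meanD (has_mean_cst (jump_law : probability T R) 1)
  (has_meanD (has_meanZ 2 (has_mean_vdot integrable_sqnorm_jump_law u0))
             (has_mean_sqr_vdot integrable_sqnorm_jump_law u0)).
rewrite -/(V u0) V_u0 -/m.
rewrite (eq_integral (fun x => ((1 + vdot u0 x) ^+ 2)%:E)); last first.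
  by move=> x _; congr (_%:E); rewrite /=; ring.
rewrite (ge0_integral_jump_law (f := fun x => (1 + vdot u0 x) ^+ 2)); last 2 first.
- exact: measurable_sqr_vdot.
- by move=> x; exact: sqr_ge0.
rewrite eseries0; last first.
  by move=> k _ _; rewrite vdot_u0_jump subrr expr0n/= mulr0.
by move=> [/eqP]; lra.
Qed.

Let X := ccp (jump_law : probability T R).

Lemma radial_pole_u0 : radial_pole X u0 = 0%E.
Proof.
apply: radial_pole0 => s s0; rewrite variance_form_ccp -?/(V u0) ?V_u0; last first.
  exact: integrable_sqnorm_jump_law.
rewrite mul1r /cumulant unlock.
have J_exp : (\int[jump_law]_x (expR (vdot (s *: u0) x))%:E = (expR (- s))%:E)%E.
  rewrite (ge0_integral_jump_law (f := fun x => expR (vdot (s *: u0) x))).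
  - rewrite -[RHS]mul1e -sum_jump_weight muleC -nneseriesZl; last first.
      by move=> k _; rewrite lee_fin jump_weight_ge0.
    apply: eq_eseriesr => k _.
    by rewrite -EFinM vdotZ vdot_u0_jump mulrN1 mulrC.
  - by have := measurable_expR_vdot (s *: u0) 0; under eq_fun do rewrite add0r.
  - by move=> x; exact: expR_ge0.
have -> : (\int[ccp_law jump_law]_w (expR (vdot (s *: u0) (X w)))%:E =
    (expR (s + (expR (- s) - 1)))%:E)%E.
  transitivity (\int[ccp_law jump_law]_w (expR (0 + vdot (s *: u0) w))%:E)%E.
    by apply: eq_integral => w _; rewrite add0r.
  rewrite (integral_cpois_expR _ _ _ J_exp)/= add0r !mul1r vdotZ vdot_drift mean_u0.
  by rewrite opprK mulr1.
rewrite lne_EFin ?expR_gt0// expRK lee_fin.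
by have := expRN_le_quadratic s0; lra.
Qed.

Lemma radial_pole_jump_infinite t : 0 < t 0 y1 -> radial_pole X t = +oo%E.
Proof.
move=> t1; apply: radial_pole_infinite.
- exact: integrable_sqnorm_jump_law.
- apply: jump_law_nondegenerate; apply: contraTneq t1 => ->.
  by rewrite mxE ltxx.
move=> s s0; rewrite (ge0_integral_jump_law (f := fun x => expR (s * vdot t x))).
(* A lower bound uniform in k: keeping only the cubic term of e^(s t_1 2^k) yields (s t_1)^3 8^k /
   6, whose factor 8^k cancels the weight 8^-k. *)
- apply: (@nneseries_ge_cst _ _
    (7 / 8 * expR (- (s * t 0 y0)) * ((s * t 0 y1) ^+ 3 / 6))).
    by rewrite !mulr_gt0 ?expR_gt0 ?exprn_gt0 ?mulr_gt0 ?invr_gt0.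
  move=> k; rewrite lee_fin vdot_jump /jump_weight.
  rewrite [leRHS](_ : _ = 7 / 8 * expR (- (s * t 0 y0)) *
      (8^-1 ^+ k * expR (s * (t 0 y1 * 2 ^+ k)))); last first.
    by rewrite mulrBr expRD; ring.
  rewrite ler_pM2l; last by rewrite mulr_gt0 ?expR_gt0//; lra.
  have a0 : 0 <= s * (t 0 y1 * 2 ^+ k) by rewrite !mulr_ge0 ?exprn_ge0 ?ltW.
  (* The index 2 gives exponent 3: 1 + x^3/3! <= e^x for x >= 0. *)
  have := expR_ge1Dxn 2 a0; rewrite (_ : 3`!%:R = 6 :> R)// => e_ge.
  apply: le_trans (_ : 8^-1 ^+ k * ((s * (t 0 y1 * 2 ^+ k)) ^+ 3 / 6) <= _).
    have e : (8^-1) ^+ k * (2 ^+ k) ^+ 3 = 1 :> R.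
      by rewrite -exprM mulnC exprM -exprMn (_ : _ * _ = 1) ?expr1n//; field.
    rewrite [leRHS](_ : _ = (8^-1 ^+ k * (2 ^+ k) ^+ 3) * ((s * t 0 y1) ^+ 3 / 6)).
      by rewrite e mul1r.
    by field.
  rewrite ler_pM2l ?exprn_gt0 ?invr_gt0//.
  by apply: le_trans e_ge; rewrite lerDr.
- rewrite (_ : (fun x => _) = (fun x : T => expR (0 + vdot (s *: t) x))).
    exact: measurable_expR_vdot.
  by apply/funext => x; rewrite add0r vdotZ.
- by move=> x; exact: expR_ge0.
Qed.

(** * Unit directions tending to the first axis *)

Definition direction (a : R) : 'rV[R]_2 :=
  cos a *: delta_mx 0 y0 + sin a *: delta_mx 0 y1.

Lemma direction0 : direction 0 = u0.
Proof. by rewrite /direction cos0 sin0 scale1r scale0r addr0. Qed.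

Lemma unit_vector_direction a : unit_vector (direction a).
Proof.
rewrite /unit_vector !big_ord_recl big_ord0 !mxE/= !(mulr0, mulr1, addr0, add0r).
by rewrite cos2Dsin2 sqrtr1.
Qed.

Lemma cvg_direction : direction n.+1%:R^-1 @[n --> \oo] --> u0.
Proof.
rewrite -direction0; have inv0 : (n.+1%:R^-1 : R) @[n --> \oo] --> (0 : R).
  exact: cvg_harmonic.
apply: cvgD; apply: cvgZr_tmp.
  exact: (cvg_comp _ _ inv0 (@continuous_cos R 0)).
exact: (cvg_comp _ _ inv0 (@continuous_sin R 0)).
Qed.

Lemma sin_invSn_gt0 n : 0 < sin (n.+1%:R^-1 : R).
Proof.
apply: sin_gt0_pi; rewrite invr_gt0 ltr0n/=.
apply: le_lt_trans (_ : 1 < _); first by rewrite invf_le1// ler1n.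
by apply: lt_le_trans (pi_ge2 R); rewrite ltr1n.
Qed.

Lemma radial_pole_direction n : radial_pole X (direction n.+1%:R^-1) = +oo%E.
Proof.
apply: radial_pole_jump_infinite.
by rewrite !mxE/= mulr0 mulr1 add0r; exact: sin_invSn_gt0.
Qed.

End Example.

Theorem proposition4p3 (R : realType) :
  exists (disp : measure_display) (Omega : measurableType disp)
         (P : probability Omega R) (X : {RV P >-> 2.-tuple R}),
    [/\ centered_compound_poisson X,
        finite_second_moment X,
        pdmx (covmx X) &
        exists (u0 : 'rV[R]_2) (u : nat -> 'rV[R]_2),
          [/\ unit_vector u0,
              radial_pole X u0 = 0%E,
              forall n, unit_vector (u n),
              u n @[n --> \oo] --> u0 &
              forall n, radial_pole X (u n) = +oo%E]].
Proof.
exists _, _, _, (ccp (@jump_law R)); split.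
- apply: centered_compound_poisson_ccp; last exact: jump_law_vzero.
  exact: integrable_sqnorm_jump_law.
- apply: finite_second_moment_ccp; exact: integrable_sqnorm_jump_law.
- apply: pdmx_covmx_ccp; first exact: integrable_sqnorm_jump_law.
  exact: jump_law_nondegenerate.
- exists (delta_mx 0 ord0), (fun n => direction n.+1%:R^-1); split.
  + by rewrite -direction0; exact: unit_vector_direction.
  + exact: radial_pole_u0.
  + by move=> n; exact: unit_vector_direction.
  + exact: cvg_direction.
  + exact: radial_pole_direction.
Qed.
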